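(* For complex $q$ with $|q|<1$, $$\sum_{m,n \geq1} \frac{(-q)^{2mn+m-1}}{(1+q^{2n-1})(1-q^{2m-1})} = \sum_{n\geq1} \frac{q^{4n-2}}{(1-q^{4n-2})^2}.$$ *)

(* Defs.v *)
From mathcomp Require Export all_boot all_order all_algebra finmap complex.
From mathcomp Require Export all_classical all_reals all_analysis.
(* Not imported: its [sum] would shadow the sum type. *)
From mathcomp Require summability.
Export numFieldNormedType.Exports.

(* Main.v *)
(* Put x = -q, u_n = x^n / (1 - x^(2n)) and p_n = x^(2n) / (1 - x^(2n)), so that
   x^n / (1 + x^n) = u_n - p_n.  Expanding 1 / (1 - x^(2n-1)) geometrically and summing over n
   first turns the left-hand side into the sum of (u_b - p_b) u_K over K >= 1 and odd b < 2K,
   while the right-hand side is the sum of u_b^2 over odd b, i.e. the terms b = K of u_b u_K.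
   The other terms of u_b u_K cancel against the p_b u_K: writing b = 2j+1, K = j+k+1, the pairs
   (j,k) and (k,j) with k = j + d contribute u_d (p_(2j+1) - p_(2(j+d)+1)), because
   u_b u_(b+d) = u_d (p_b - p_(b+d)); summed over j this telescopes to the sum of
   u_d p_b over odd b < 2d. *)
From mathcomp Require Import ring zify.
Require Import Defs.
Import Order.TTheory GRing.Theory Num.Theory.
Local Open Scope classical_set_scope.
Local Open Scope ring_scope.
#[local] Existing Instance summability.totally_filter.


(** * Unconditional summation over arbitrary index sets *)

Definition has_sum {I : choiceType} {K : numFieldType} (f : I -> K) (s : K) : Prop :=
  summability.partial_sum f @ summability.totally --> s.

Definition abs_summable {I : choiceType} {K : numFieldType} (f : I -> K) : Prop :=
  exists M : K, forall A : {fset I}, \sum_(i <- A) `|f i| <= M.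

(** This isolates the analytic input: the summation arguments stay in an abstract [K], and
    [complex_abs_complete] supplies the case of [R[i]]. *)
Definition abs_complete (K : numFieldType) : Prop :=
  forall (I : choiceType) (f : I -> K), abs_summable f -> exists s, has_sum f s.

Lemma has_sumP {I : choiceType} {K : numFieldType} {f : I -> K} {s : K} :
  has_sum f s <->
  forall e : K, 0 < e -> exists A : {fset I}, forall B : {fset I},
    (A `<=` B)%fset -> `|s - \sum_(i <- B) f i| < e.
Proof.
rewrite /has_sum; split.
  move=> /cvgrPdist_lt h e e0; have [A _ AB] := h e e0.
  by exists A => //= B /AB; rewrite /summability.partial_sum big_seq_fsetE.
move=> h; apply/cvgrPdist_lt => e e0; have [A AB] := h e e0.
by exists A => //= B /AB; rewrite /summability.partial_sum big_seq_fsetE.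
Qed.

Lemma has_sum_unique {I : choiceType} {K : numFieldType} {f : I -> K} {s t : K} :
  has_sum f s -> has_sum f t -> s = t.
Proof. by apply: cvg_unique; exact: norm_hausdorff. Qed.

Lemma has_sumD {I : choiceType} {K : numFieldType} {f g : I -> K} {s t : K} :
  has_sum f s -> has_sum g t -> has_sum (fun i => f i + g i) (s + t).
Proof.
move=> fs gt; rewrite /has_sum.
rewrite (_ : summability.partial_sum _ =
  summability.partial_sum f + summability.partial_sum g); first exact: cvgD.
by apply/funext => A; rewrite /summability.partial_sum big_split.
Qed.

Lemma has_sumZ {I : choiceType} {K : numFieldType} (c : K) {f : I -> K} {s : K} :
  has_sum f s -> has_sum (fun i => c * f i) (c * s).
Proof.
move=> fs; rewrite /has_sum.
rewrite (_ : summability.partial_sum _ =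
  (fun A => c * summability.partial_sum f A)); first exact: cvgMl_tmp.
by apply/funext => A; rewrite /summability.partial_sum big_distrr.
Qed.

Lemma has_sumB {I : choiceType} {K : numFieldType} {f g : I -> K} {s t : K} :
  has_sum f s -> has_sum g t -> has_sum (fun i => f i - g i) (s - t).
Proof.
move=> fs /(has_sumZ (-1)) gt; have := has_sumD fs gt.
by rewrite mulN1r; congr (has_sum _ _); apply/funext => i; rewrite mulN1r.
Qed.

Lemma has_sum_big {I : choiceType} {K : numFieldType} {J : Type} (r : seq J)
    {f : J -> I -> K} {s : J -> K} :
  (forall j, has_sum (f j) (s j)) ->
  has_sum (fun i => \sum_(j <- r) f j i) (\sum_(j <- r) s j).
Proof.
move=> fs; elim: r => [|j r IH].
  rewrite big_nil; apply/has_sumP => e e0; exists fset0 => B _.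
  by rewrite big1 ?subrr ?normr0// => i _; rewrite big_nil.
rewrite big_cons; have := has_sumD (fs j) IH.
by congr (has_sum _ _); apply/funext => i; rewrite big_cons.
Qed.

Lemma has_sum_delta {I : choiceType} {K : numFieldType} (i0 : I) (c : K) :
  has_sum (fun i => if i == i0 then c else 0) c.
Proof.
apply/has_sumP => e e0; exists [fset i0]%fset => B; rewrite fsub1set => iB.
rewrite (big_fsetD1 i0) //= eqxx big1_fset ?addr0 ?subrr ?normr0// => i.
by rewrite in_fsetD1 => /andP[/negPf ->].
Qed.

Lemma has_sum_reindex {I J : choiceType} {K : numFieldType} {h : J -> I}
    {f : I -> K} {s : K} :
  injective h -> (forall i, f i != 0 -> exists j, i = h j) ->
  has_sum f s -> has_sum (fun j => f (h j)) s.
Proof.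
move=> h_inj f0 /has_sumP fs; apply/has_sumP => e /fs [A AB].
(* The preimage of a finite set under an injection lies in a finite set; induction on [A], one point
   at a time. *)
have [A1 A1P] : exists A1 : {fset J}, forall j, h j \in A -> j \in A1.
  elim/finSet_rect: A {AB} => A IH.
  have [->|[i iA]] := fset_0Vmem A; first by exists fset0 => j; rewrite inE.
  have [A1 A1P] := IH _ (fproperD1 iA).
  have [[j0 ij0]|ni] := pselect (exists j, i = h j).
    exists (j0 |` A1)%fset => j hj; rewrite !inE; have [//|/eqP jj0] := eqVneq j j0.
    apply/A1P; rewrite !inE hj andbT ij0; apply/eqP => /h_inj; exact: jj0.
  exists A1 => j hj; apply/A1P; rewrite !inE hj andbT; apply/eqP => hji.
  by apply: ni; exists j.
exists A1 => B A1B.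
have := AB (A `|` [fset h j | j in B])%fset (fsubsetUl _ _).
rewrite -(big_fset_incl _ (fsubsetUr A [fset h j | j in B]%fset)).
  by rewrite big_imfset//= => x y _ _; apply: h_inj.
(* An index of [A] outside the image of [B] carries a zero term: otherwise it is [h j] with [j] in
   [A1], hence in [B]. *)
move=> i; rewrite in_fsetU => /orP[iA niB|-> //].
apply/eqP; apply: contraNT niB => /f0[j ij]; apply/imfsetP; exists j => //=.
by apply: (fsubsetP A1B); apply: A1P; rewrite -ij.
Qed.

Lemma big_fsetM {I J : choiceType} {V : nmodType} (A : {fset I}) (B : {fset J})
    (f : I * J -> V) :
  \sum_(p <- (A `*` B)%fset) f p = \sum_(i <- A) \sum_(j <- B) f (i, j).
Proof. by rewrite /fsetM big_imfset2//= => -[? ?] [? ?] _ _ /= [-> ->]. Qed.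

(** A finite rectangle containing [A] has its sum within e/2 of [s]. Once its rows [B] are fixed,
    enough columns [D] also bring that sum within e/2 of the sum of the row totals over [B]. *)
Lemma has_sum_fubini {I J : choiceType} {K : numFieldType}
    {f : I * J -> K} {g : I -> K} {s : K} :
  has_sum f s -> (forall i, has_sum (fun j => f (i, j)) (g i)) ->
  has_sum g s.
Proof.
move=> /has_sumP fs rows; apply/has_sumP => e e0.
have e2 : 0 < e / 2 by rewrite divr_gt0.
have [A AP] := fs _ e2.
exists [fset p.1 | p in A]%fset => B AB.
have /has_sumP /(_ _ e2) [C CP] := has_sum_big B rows.
set D := (C `|` [fset p.2 | p in A])%fset.
have h1 := CP D (fsubsetUl _ _).
have h2 : `|s - \sum_(i <- B) \sum_(j <- D) f (i, j)| < e / 2.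
  have -> : \sum_(i <- B) \sum_(j <- D) f (i, j) = \sum_(p <- (B `*` D)%fset) f p.
    by rewrite big_fsetM.
  apply: AP; apply/fsubsetP => p pA; rewrite in_fsetM; apply/andP; split.
    by apply: (fsubsetP AB); apply/imfsetP; exists p.
  by rewrite in_fsetU; apply/orP; right; apply/imfsetP; exists p.
rewrite exchange_big /= in h1; rewrite (splitr e).
by apply: le_lt_trans (ltrD h2 h1); rewrite [X in _ <= _ + X]distrC; exact: ler_distD.
Qed.

(** * Convergence of absolutely summable complex families *)

Lemma has_sum_nonneg {I : choiceType} {R : realType} (g : I -> R) (M : R) :
  (forall i, 0 <= g i) -> (forall A : {fset I}, \sum_(i <- A) g i <= M) ->
  exists s, has_sum g s.
Proof.
move=> g0 gM; pose E := [set \sum_(i <- A) g i | A in [set: {fset I}]].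
have supE : has_sup E.
  split; first by exists (\sum_(i <- fset0) g i); exists fset0.
  by exists M => _ [A _ <-].
exists (sup E); apply/has_sumP => e e0.
have [_ [A _ <-] sA] := sup_adherent e0 supE.
exists A => B AB.
have BE : \sum_(i <- B) g i <= sup E by apply: ub_le_sup; [case: supE | exists B].
have AleB : \sum_(i <- A) g i <= \sum_(i <- B) g i.
  rewrite [leRHS](big_fsetID _ (mem A)) /= (_ : [fset x in B | x \in A]%fset = A).
    by rewrite lerDl sumr_ge0.
  apply/fsetP => i; rewrite !inE /= andbC; case: (boolP (i \in A)) => //= iA.
  exact: (fsubsetP AB).
rewrite ger0_norm ?subr_ge0// ltrBlDr -ltrBlDl.
exact: lt_le_trans sA AleB.
Qed.

Lemma has_sum_complex {I : choiceType} {R : realType} {g : I -> R} {s : R} :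
  has_sum g s -> has_sum (fun i => (g i)%:C%C) s%:C%C.
Proof.
(* A positive [e] in the order of [R[i]] is real, so its real part serves as the tolerance. *)
move=> /has_sumP gs; apply/has_sumP => e; rewrite ltcE /= => /andP[/eqP Ime Ree].
have [A AP] := gs _ Ree; exists A => B /AP.
rewrite -raddf_sum -raddfB normc_def /= expr0n addr0 sqrtr_sqr => h.
by rewrite ltcE /= Ime eqxx.
Qed.

Lemma complex_abs_complete (R : realType) : abs_complete R[i].
Proof.
move=> I f [M fM].
(* A real-valued [h] dominated by the modulus is (|h| + h) - |h|, a difference of nonnegative
   families with bounded finite sums. *)
have bound (h : R[i] -> R) : (forall z, (`|h z|%:C)%C <= `|z|) ->
    exists s, has_sum (fun i => (h (f i))%:C%C) s.
  move=> hz.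
  have hA (A : {fset I}) : \sum_(i <- A) `|h (f i)| <= complex.Re M.
    have : ((\sum_(i <- A) `|h (f i)|)%:C)%C <= M.
      by apply: le_trans (fM A); rewrite raddf_sum; apply: ler_sum => i _; exact: hz.
    by rewrite lecE /= => /andP[].
  have [s hs] := has_sum_nonneg (fun i => `|h (f i)|) _ (fun=> normr_ge0 _) hA.
  have [|A|t ht] := has_sum_nonneg (fun i => `|h (f i)| + h (f i))
     (complex.Re M + complex.Re M).
  - by move=> i; rewrite -lerBlDl sub0r; case/ler_normlP: (lexx `|h (f i)|); rewrite lerNl.
  - rewrite big_split lerD//; apply: le_trans (hA A); apply: ler_sum => i _.
    exact: ler_norm.
  exists (t - s)%:C%C; have := has_sum_complex (has_sumB ht hs).
  by congr (has_sum _ _); apply/funext => i; rewrite addrC addKr.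
have [a ha] := bound _ (@normc_ge_Re R).
have [b hb] : exists s, has_sum (fun i => (complex.Im (f i))%:C%C) s.
  have i1 : `|'i%C : R[i]| = 1 by rewrite normc_def /= expr0n expr1n add0r sqrtr1.
  (* Im z is the real part of -z i, and |i| = 1. *)
  apply: bound => z; have := normc_ge_Re (- z * 'i%C).
  by rewrite ReiNIm raddfN opprK normrM normrN i1 mulr1.
exists (a + 'i%C * b); have := has_sumD ha (has_sumZ 'i%C hb).
by congr (has_sum _ _); apply/funext => i; rewrite -complexE.
Qed.

(** * Closure properties of absolute summability *)

Lemma abs_summable_le {I : choiceType} {K : numFieldType} {f g : I -> K} :
  (forall i, `|f i| <= g i) -> abs_summable g -> abs_summable f.
Proof.
move=> fg [M gM]; exists M => A; apply: le_trans (gM A); apply: ler_sum => i _.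
by rewrite (ger0_norm (le_trans _ (fg i))).
Qed.

Lemma abs_summable_if {I : choiceType} {K : numFieldType} (P : pred I) {f : I -> K} :
  abs_summable f -> abs_summable (fun i => if P i then f i else 0).
Proof.
move=> [M fM]; exists M => A; apply: le_trans (fM A); apply: ler_sum => i _.
by case: ifP; rewrite ?normr0.
Qed.

Lemma abs_summableZ {I : choiceType} {K : numFieldType} (c : K) {f : I -> K} :
  abs_summable f -> abs_summable (fun i => c * f i).
Proof.
move=> [M fM]; exists (`|c| * M) => A.
by under eq_bigr do rewrite normrM; rewrite -big_distrr ler_wpM2l.
Qed.

(** A finite set of pairs lies in the product of its projections, where the sum of norms factors. *)
Lemma abs_summable_prod {I J : choiceType} {K : numFieldType} {f : I -> K} {g : J -> K} :
  abs_summable f -> abs_summable g -> abs_summable (fun p : I * J => f p.1 * g p.2).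
Proof.
move=> [M fM] [N gN]; exists (M * N) => A.
have N0 : 0 <= N by apply: le_trans (gN fset0); rewrite sumr_ge0.
pose B := [fset p.1 | p in A]%fset; pose C := [fset p.2 | p in A]%fset.
apply: (@le_trans _ _ (\sum_(i <- B) \sum_(j <- C) `|f i * g j|)).
  rewrite -(big_fsetM B C (fun p => `|f p.1 * g p.2|)) [leRHS](big_fsetID _ (mem A)) /=.
  set D := [fset x in _ | _]%fset; rewrite (_ : D = A); first by rewrite lerDl sumr_ge0.
  apply/fsetP => p; rewrite !inE /=; case: (boolP (p \in A)) => pA; last by rewrite andbF.
  rewrite andbT; apply/andP; split; apply/imfsetP; by exists p.
under eq_bigr => i _ do (under eq_bigr do rewrite normrM; rewrite -big_distrr).
rewrite -big_distrl /=; apply: ler_pM => //; exact: sumr_ge0.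
Qed.

(** * Geometric series *)

Lemma abs_summable_geometric {K : numFieldType} (r : K) :
  0 <= r -> r < 1 -> abs_summable (fun n : nat => r ^+ n).
Proof.
move=> r0 r1; exists (1 - r)^-1 => A.
have [N AN] : exists N : nat, forall n, n \in A -> (n < N)%N.
  exists (\max_(n <- A) n).+1 => n nA; rewrite ltnS.
  exact: (@leq_bigmax_seq _ _ xpredT id).
apply: (@le_trans _ _ (\sum_(0 <= n < N) r ^+ n)).
  under eq_bigr => n _ do rewrite (ger0_norm (exprn_ge0 _ r0)).
  rewrite (eq_fbigl _ (B := [fset n in iota 0 N | n \in A]%fset)); last first.
    move=> n; rewrite !inE /= mem_iota /= add0n; case: (boolP (n \in A)) => //= nA.
      by rewrite AN.
    by rewrite andbF.
  rewrite big_fset /= undup_id ?iota_uniq// /index_iota subn0 [leRHS](bigID (fun n => n \in A)) /= lerDl.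
  by apply: sumr_ge0 => n _; exact: exprn_ge0.
have := geometric_seriesE 1 (negbT (lt_eqF r1)); move=> /(congr1 (fun f => f N)).
rewrite /series /geometric /= !mul1r => H; under eq_bigr do rewrite -[_ ^+ _]mul1r.
by rewrite H -[leRHS]mul1r ler_wpM2r ?invr_ge0 ?subr_ge0 ?gerBl ?exprn_ge0// ltW.
Qed.

(** Completeness gives a sum t of the x^n. Dropping the first term and multiplying by x both produce
    the family x^(n+1), so t - 1 = x t. *)
Lemma has_sum_geometric {K : numFieldType} (c x : K) : abs_complete K ->
  `|x| < 1 -> has_sum (fun n : nat => c * x ^+ n) (c / (1 - x)).
Proof.
move=> Kc x1.
have x1' : 1 - x != 0.
  by apply: contraTneq x1 => /eqP; rewrite subr_eq0 => /eqP <-; rewrite normr1 ltxx.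
have [t ht] : exists t, has_sum (fun n : nat => x ^+ n) t.
  apply: Kc; apply: abs_summable_le (abs_summable_geometric `|x| _ _) => //.
  by move=> n; rewrite normrX.
have h1 : has_sum (fun n => x ^+ n.+1) (t - 1).
  (* With the term at 0 subtracted, the support lies in the range of the successor. *)
  have := has_sumB ht (has_sum_delta 0%N 1).
  move=> /(has_sum_reindex succn_inj) h; have {h} := h _; rewrite /=.
  have -> : (fun j => x ^+ j.+1 - (if j.+1 == 0%N then 1 else 0)) = (fun n => x ^+ n.+1).
    by apply/funext => n; rewrite subr0.
  apply; case => [|n]; first by rewrite expr0 subrr eqxx.
  by exists n.
have h2 : has_sum (fun n => x ^+ n.+1) (x * t).
  by have := has_sumZ x ht; congr (has_sum _ _); apply/funext => n; rewrite exprS.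
have E := has_sum_unique h1 h2.
rewrite (_ : (1 - x)^-1 = t); first exact: has_sumZ.
by apply: (mulfI x1'); rewrite mulfV// mulrBl mul1r -E subKr.
Qed.

Lemma has_sum_cvg_series {K : numFieldType} {f : nat -> K} {s : K} :
  has_sum f s -> (\sum_(0 <= n < N) f n) @[N --> \oo] --> s.
Proof.
move=> /has_sumP fs; apply/cvgrPdist_lt => e /fs[A AP].
exists (\max_(n <- A) n).+1 => // N /= AN.
have := AP [fset n in iota 0 N | true]%fset; rewrite big_fset /=.
rewrite undup_id ?iota_uniq// /index_iota subn0; apply.
apply/fsubsetP => n nA; rewrite !inE /= mem_iota /= add0n andbT.
apply: leq_trans AN; rewrite ltnS; exact: (@leq_bigmax_seq _ _ xpredT id).
Qed.

(** * Splitting double sums into regions *)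

Lemma has_sum_split {I : choiceType} {K : numFieldType} (P : pred I) {f : I -> K} {s : K} :
  abs_complete K -> abs_summable f -> has_sum f s ->
  exists a b, [/\ has_sum (fun i => if P i then f i else 0) a,
                  has_sum (fun i => if ~~ P i then f i else 0) b & s = a + b].
Proof.
move=> Kc fs hs.
have [a ha] := Kc _ _ (abs_summable_if P fs).
have [b hb] := Kc _ _ (abs_summable_if (predC P) fs).
exists a, b; split => //; apply: has_sum_unique hs _.
have := has_sumD ha hb; congr (has_sum _ _); apply/funext => i /=.
by case: (P i); rewrite ?addr0 ?add0r.
Qed.

Lemma has_sum_reindex_if {I J : choiceType} {K : numFieldType} (h : J -> I)
    (P : pred I) {f : I -> K} {s : K} :
  injective h -> (forall j, P (h j)) -> (forall i, P i -> exists j, i = h j) ->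
  has_sum (fun i => if P i then f i else 0) s -> has_sum (fun j => f (h j)) s.
Proof.
move=> h_inj Ph hP fs.
have := has_sum_reindex h_inj _ fs.
rewrite (_ : (fun j => _) = (fun j => f (h j))); first apply.
  by move=> i; case: ifP => [/hP//|]; rewrite eqxx.
by apply/funext => j; rewrite Ph.
Qed.

(** The second family is, in row d = [p.2], the tail from column d + 1 on. Removing it leaves the
    columns 0 to d; this is how the telescoping sum is evaluated later. *)
Lemma has_sum_split_lower {K : numFieldType} {f : nat * nat -> K} {s : K} :
  abs_complete K -> abs_summable f -> has_sum f s ->
  exists a b, [/\ has_sum (fun p : nat * nat => f (p.1 + p.2, p.1)%N) a,
                  has_sum (fun p : nat * nat => f (p.2, p.1 + p.2.+1)%N) b & s = a + b].
Proof.
move=> Kc fs /(has_sum_split (fun p : nat * nat => (p.2 <= p.1)%N) Kc fs)[a [b [ha hb ->]]].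
exists a, b; split => //.
- apply: (has_sum_reindex_if (fun p : nat * nat => (p.1 + p.2, p.1)%N)) ha
    => [[m k] [m' k']|p|[d m]] /=.
  + by case=> /[swap] -> /addnI ->.
  + exact: leq_addr.
  + by move=> md; exists (m, d - m)%N; rewrite /= subnKC.
- apply: (has_sum_reindex_if (fun p : nat * nat => (p.2, p.1 + p.2.+1)%N)) hb
    => [[m k] [m' k']|p|[d m]] /=.
  + by case=> -> /addIn ->.
  + by rewrite -ltnNge leq_addl.
  + by rewrite -ltnNge => md; exists (m - d.+1, d)%N; rewrite /= subnK.
Qed.

(** Both triangles are parametrized by the smaller index and the gap minus 1, so that mirror terms
    can be added pairwise. *)
Lemma has_sum_split_diag {K : numFieldType} {f : nat * nat -> K} {s : K} :
  abs_complete K -> abs_summable f -> has_sum f s ->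
  exists a b, [/\ has_sum (fun m : nat => f (m, m)) a,
    has_sum (fun p : nat * nat => f (p.1, p.1 + p.2.+1)%N + f (p.1 + p.2.+1, p.1)%N) b
    & s = a + b].
Proof.
move=> Kc fs /(has_sum_split (fun p : nat * nat => p.1 == p.2) Kc fs)[a [b [ha hb ->]]].
have gs := abs_summable_if (fun p : nat * nat => p.1 != p.2) fs.
have [c [d [hc hd ->]]] := has_sum_split (fun p : nat * nat => (p.1 < p.2)%N) Kc gs hb.
exists a, (c + d); split => //.
  apply: (has_sum_reindex_if (fun m : nat => (m, m))) ha => [m m'|m|[m m']] /=.
  - by case.
  - exact: eqxx.
  - by move=> /eqP <-; exists m.
have E1 : (fun p : nat * nat => if (p.1 < p.2)%N then if p.1 != p.2 then f p else 0 else 0)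
    = (fun p => if (p.1 < p.2)%N then f p else 0).
  by apply/funext => p; case: ltngtP.
have E2 : (fun p : nat * nat => if ~~ (p.1 < p.2)%N then if p.1 != p.2 then f p else 0 else 0)
    = (fun p => if (p.2 < p.1)%N then f p else 0).
  by apply/funext => p; case: ltngtP.
rewrite E1 in hc; rewrite E2 in hd.
apply: has_sumD.
- apply: (has_sum_reindex_if (fun p : nat * nat => (p.1, p.1 + p.2.+1)%N)) hc
    => [[m k] [m' k']|p|[j k]] /=.
  + by case=> -> /addnI[->].
  + by rewrite addnS ltnS leq_addr.
  + by move=> jk; exists (j, k - j.+1)%N => /=; congr pair; lia.
- apply: (has_sum_reindex_if (fun p : nat * nat => (p.1 + p.2.+1, p.1)%N)) hd
    => [[m k] [m' k']|p|[j k]] /=.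
  + by case=> /[swap] -> /addnI[->].
  + by rewrite addnS ltnS leq_addr.
  + by move=> jk; exists (k, j - k.+1)%N => /=; congr pair; lia.
Qed.

(* If x = exp (-t), this is 1 / (2 sinh (n t)). *)
Definition csch {K : fieldType} (x : K) (n : nat) : K := x ^+ n / (1 - x ^+ (2 * n)).

(** If x = exp (-t), this is 1 / (exp (2 n t) - 1) = (coth (n t) - 1) / 2. *)
Definition lam {K : fieldType} (x : K) (n : nat) : K := x ^+ (2 * n) / (1 - x ^+ (2 * n)).

(** * Bounds and identities for [csch] and [lam] *)

Lemma exprn_norm_le {K : numFieldType} (x : K) (m n : nat) :
  `|x| < 1 -> (m <= n)%N -> `|x ^+ n| <= `|x| ^+ m.
Proof. by move=> x1 mn; rewrite normrX ler_wiXn2l// ltW. Qed.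

Lemma subr1X_neq0 {K : numFieldType} (x : K) (n : nat) :
  `|x| < 1 -> (0 < n)%N -> 1 - x ^+ n != 0.
Proof.
move=> x1 n0; rewrite subr_eq0; apply/eqP => /(congr1 Num.norm).
rewrite normr1 => /esym E; have := exprn_norm_le x 1 n x1 n0.
by rewrite E expr1 real_leNgt ?num_real ?x1// ?realE ?ler01 ?normr_ge0.
Qed.

(** If x^n = -1 then x^(2n) = 1, which [subr1X_neq0] excludes. *)
Lemma addr1X_neq0 {K : numFieldType} (x : K) (n : nat) :
  `|x| < 1 -> (0 < n)%N -> 1 + x ^+ n != 0.
Proof.
move=> x1 n0; have := subr1X_neq0 x (n * 2) x1; rewrite muln_gt0 n0 => /(_ isT).
apply: contraNneq => xn; rewrite exprM (_ : x ^+ n = -1) ?sqrrN ?expr1n ?subrr//.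
by apply/eqP; rewrite -addr_eq0 addrC xn.
Qed.

Lemma norm_inv_subr1_le {K : numFieldType} (r y : K) :
  0 <= r -> r < 1 -> `|y| <= r -> `|(1 - y)^-1| <= (1 - r)^-1.
Proof.
move=> r0 r1 yr; have r1' : 0 < 1 - r by rewrite subr_gt0.
have h : 1 - r <= `|1 - y|.
  by apply: le_trans (lerB_dist _ _); rewrite normr1 lerB.
by rewrite normfV lef_pV2// posrE// (lt_le_trans r1').
Qed.

Lemma norm_csch_le {K : numFieldType} (x : K) (n : nat) : `|x| < 1 -> (0 < n)%N ->
  `|csch x n| <= (1 - `|x|)^-1 * `|x| ^+ n.
Proof.
move=> x1 n0; rewrite /csch normrM mulrC; apply: ler_pM => //; last by rewrite normrX.
by apply: norm_inv_subr1_le => //; apply: (exprn_norm_le x 1) => //; rewrite muln_gt0.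
Qed.

Lemma norm_lam_le {K : numFieldType} (x : K) (n : nat) : `|x| < 1 -> (0 < n)%N ->
  `|lam x n| <= (1 - `|x|)^-1 * `|x| ^+ n.
Proof.
move=> x1 n0; rewrite /lam normrM mulrC; apply: ler_pM => //.
  by apply: norm_inv_subr1_le => //; apply: (exprn_norm_le x 1) => //; rewrite muln_gt0.
by apply: exprn_norm_le => //; rewrite leq_pmull.
Qed.

Lemma csch_sub_lam {K : numFieldType} (x : K) (n : nat) : `|x| < 1 -> (0 < n)%N ->
  csch x n - lam x n = x ^+ n / (1 + x ^+ n).
Proof.
move=> x1 n0; rewrite /csch /lam.
have := addr1X_neq0 x n x1 n0.
have := subr1X_neq0 x (2 * n) x1; rewrite muln_gt0 n0 => /(_ isT).
by rewrite mulnC exprM; move: (x ^+ n) => y *; field; apply/andP.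
Qed.

(** The closed form with denominator 1 + x^n keeps the constant of the two separate bounds; the
    triangle inequality would double it. *)
Lemma norm_csch_sub_lam_le {K : numFieldType} (x : K) (n : nat) : `|x| < 1 -> (0 < n)%N ->
  `|csch x n - lam x n| <= (1 - `|x|)^-1 * `|x| ^+ n.
Proof.
move=> x1 n0; rewrite csch_sub_lam// normrM mulrC -[X in 1 + X]opprK.
apply: ler_pM => //; last by rewrite normrX.
by apply: norm_inv_subr1_le => //; rewrite normrN; apply: (exprn_norm_le x 1).
Qed.

(** In hyperbolic form: coth A - coth B = sinh (B - A) / (sinh A sinh B), with A = b t and B = (b +
    d) t. *)
Lemma csch_mul_csch {K : numFieldType} (x : K) (b d : nat) :
  `|x| < 1 -> (0 < b)%N -> (0 < d)%N ->
  csch x b * csch x (b + d) = csch x d * (lam x b - lam x (b + d)).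
Proof.
move=> x1 b0 d0; rewrite /csch /lam.
have H n : (0 < n)%N -> 1 - (x ^+ n) ^+ 2 != 0.
  by move=> n0; rewrite -exprM subr1X_neq0// muln_gt0 n0.
have := H _ b0; have := H _ d0; have := H (b + d)%N; rewrite addn_gt0 b0 => /(_ isT).
rewrite !(mulnC 2) !exprM exprD; move: (x ^+ b) (x ^+ d) => y z *.
by field; apply/and3P; split.
Qed.

(** * Evaluation of the double series *)

Lemma abs_summable_geometric2 {K : numFieldType} (r c : K) (f : nat * nat -> K) :
  0 <= r -> r < 1 -> (forall p, `|f p| <= c * (r ^+ p.1 * r ^+ p.2)) -> abs_summable f.
Proof.
move=> r0 r1 fr; apply: abs_summable_le fr _; apply: abs_summableZ.
by apply: abs_summable_prod; exact: abs_summable_geometric.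
Qed.

(** With b = 2j+1 and e = d+1, the indices are b, b+e and b+2e. Applying [csch_mul_csch] to both
    products makes the [lam] terms at b+e cancel. *)
Lemma csch_off_diagonal {K : numFieldType} (x : K) (j d : nat) : `|x| < 1 ->
  csch x (2 * j + 1) * csch x (j + (j + d.+1) + 1)
    + csch x (2 * (j + d.+1) + 1) * csch x (j + d.+1 + j + 1)
  = csch x d.+1 * lam x (2 * j + 1) - csch x d.+1 * lam x (2 * (j + d.+1) + 1).
Proof.
move=> x1; have -> : (j + (j + d.+1) + 1 = 2 * j + 1 + d.+1)%N by lia.
have -> : (j + d.+1 + j + 1 = 2 * j + 1 + d.+1)%N by lia.
have -> : (2 * (j + d.+1) + 1 = 2 * j + 1 + d.+1 + d.+1)%N by lia.
have b0 : (0 < 2 * j + 1)%N by lia.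
rewrite csch_mul_csch// [X in _ + X]mulrC csch_mul_csch//; last by rewrite addn_gt0 b0.
by ring.
Qed.

Lemma has_sum_csch_sqr {K : numFieldType} (x : K) : abs_complete K -> `|x| < 1 ->
  exists s, has_sum (fun m : nat => csch x (2 * m + 1) ^+ 2) s /\
    has_sum (fun p : nat * nat =>
      (csch x (2 * p.1 + 1) - lam x (2 * p.1 + 1)) * csch x (p.1 + p.2 + 1)) s.
Proof.
move=> Kc x1; set C := (1 - `|x|)^-1.
have x0 : 0 <= `|x| by [].
have C0 : 0 <= C by rewrite invr_ge0 subr_ge0 ltW.
have rle m n : (m <= n)%N -> `|x| ^+ n <= `|x| ^+ m by move=> ?; rewrite ler_wiXn2l// ltW.
(* In [h], the indices 2m+1 and m+k+1 agree exactly on the diagonal m = k. In [g], row [p.1] stands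
   for the difference d = [p.1] + 1. *)
pose h (p : nat * nat) := csch x (2 * p.1 + 1) * csch x (p.1 + p.2 + 1).
pose g (p : nat * nat) := csch x p.1.+1 * lam x (2 * p.2 + 1).
have hs : abs_summable h.
  apply: (abs_summable_geometric2 `|x| (C * C)) => // -[m k]; rewrite /h normrM mulrACA.
  apply: ler_pM => //=.
    by apply: le_trans (norm_csch_le x _ x1 _) _; rewrite ?addn1// ler_wpM2l// rle//; lia.
  by apply: le_trans (norm_csch_le x _ x1 _) _; rewrite ?addn1// ler_wpM2l// rle//; lia.
have gs : abs_summable g.
  apply: (abs_summable_geometric2 `|x| (C * C)) => // -[m k]; rewrite /g normrM mulrACA.
  apply: ler_pM => //=.
    by apply: le_trans (norm_csch_le x _ x1 _) _; rewrite ?addn1// ler_wpM2l// rle//; lia.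
  by apply: le_trans (norm_lam_le x _ x1 _) _; rewrite ?addn1// ler_wpM2l// rle//; lia.
have [s h_s] := Kc _ _ hs; have [t g_t] := Kc _ _ gs.
have [a [b [ha hb sab]]] := has_sum_split_diag Kc hs h_s.
have [a' [b' [ga gb tab]]] := has_sum_split_lower Kc gs g_t.
have swap_inj : injective (fun p : nat * nat => (p.2, p.1)) by move=> [? ?] [? ?] [-> ->].
have g_t' : has_sum (fun p : nat * nat => g (p.2, p.1)) t.
  by apply: (has_sum_reindex swap_inj) g_t => -[m k] _; exists (k, m).
(* The off-diagonal terms are g(d,j) - g(d,j+d+1); the second family has sum [b'], so the
   telescoping needs no limit in j. *)
have ba' : b = a'.
  rewrite (_ : a' = t - b'); last by rewrite tab addrK.
  apply: has_sum_unique hb _; have := has_sumB g_t' gb.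
  by congr (has_sum _ _); apply/funext => -[j d]; rewrite /g /h /= csch_off_diagonal.
exists a; split.
  by move: ha; congr (has_sum _ _); apply/funext => m; rewrite /h /= expr2; congr (_ * csch x _); lia.
(* The family summing to [a'] is [csch] at m+k+1 times [lam] at 2m+1, the part to subtract from
   [h]. *)
rewrite (_ : a = s - a'); last by rewrite sab ba' addrK.
have := has_sumB h_s ga; congr (has_sum _ _); apply/funext => -[m k].
by rewrite /h /g /= !addn1; ring.
Qed.

(** Both sides are iterated sums of one triple family [F]: geometric summation over k gives the
    double series, and over n it gives the family of [has_sum_csch_sqr]. *)
Lemma has_sum_double_series {K : numFieldType} (x : K) : abs_complete K -> `|x| < 1 ->
  exists s, has_sum (fun m : nat => csch x (2 * m + 1) ^+ 2) s /\
    has_sum (fun p : nat * nat => x ^+ (2 * p.1.+1 * p.2.+1 + p.1.+1 - 1)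
      / ((1 - x ^+ (2 * p.2 + 1)) * (1 + x ^+ (2 * p.1 + 1)))) s.
Proof.
move=> Kc x1; have [s [hs1 hs2]] := has_sum_csch_sqr x Kc x1; exists s; split=> //.
pose v m := csch x (2 * m + 1) - lam x (2 * m + 1).
pose F (p : nat * nat * nat) := v p.1.1 * x ^+ ((p.1.1 + p.2 + 1) * (2 * p.1.2 + 1)).
have Fs : abs_summable F.
  (* The factor |x|^m comes from [v m], the other two from (m+k+1)(2n+1) >= n+k. *)
  pose g (p : nat * nat * nat) := (1 - `|x|)^-1 * ((`|x| ^+ p.1.1 * `|x| ^+ p.1.2) * `|x| ^+ p.2).
  apply: (@abs_summable_le _ _ _ g); last first.
    apply: abs_summableZ.
    apply: (@abs_summable_prod _ _ _ (fun p : nat * nat => `|x| ^+ p.1 * `|x| ^+ p.2)).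
      by apply: abs_summable_prod; exact: abs_summable_geometric.
    exact: abs_summable_geometric.
  move=> [[m n] k]; rewrite /F /g /= normrM -(mulrA (`|x| ^+ m)) [leRHS]mulrA; apply: ler_pM => //.
    apply: le_trans (norm_csch_sub_lam_le x _ x1 _) _; rewrite ?addn1//.
    rewrite ler_wpM2l//; first by rewrite invr_ge0 subr_ge0 ltW.
    by rewrite ler_wiXn2l//; [exact: ltW | lia].
  by rewrite -exprD; apply: exprn_norm_le => //; nia.
have [t ht] := Kc _ _ Fs.
have <- : t = s.
  (* Exchanging the last two coordinates makes n the inner variable. *)
  pose rot (p : nat * nat * nat) := (p.1.1, p.2, p.1.2).
  have rot_inj : injective rot by move=> [[? ?] ?] [[? ?] ?] [-> -> ->].
  have ht' : has_sum (fun p => F (rot p)) t.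
    by apply: (has_sum_reindex rot_inj) ht => -[[m k] n] _; exists (m, n, k).
  apply: has_sum_unique hs2; apply: (has_sum_fubini ht') => -[m k] /=.
  have y1 : `|x ^+ (2 * (m + k + 1))| < 1.
    by rewrite normrX exprn_ilt1//; lia.
  have := has_sum_geometric (v m * x ^+ (m + k + 1)) _ Kc y1.
  rewrite /csch mulrA; congr (has_sum _ _); apply/funext => n.
  rewrite /F /= -mulrA -exprM -exprD; congr (_ * x ^+ _); lia.
apply: (has_sum_fubini ht) => -[m n] /=.
have y1 : `|x ^+ (2 * n + 1)| < 1 by rewrite normrX exprn_ilt1//; lia.
have := has_sum_geometric (v m * x ^+ ((m + 1) * (2 * n + 1))) _ Kc y1.
congr (has_sum _ _).
  apply/funext => k; rewrite /F /= -mulrA -exprM -exprD; congr (_ * x ^+ _); lia.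
rewrite /v csch_sub_lam//; last by rewrite addn1.
(* The exponents 2m+1 and (m+1)(2n+1) add up to 2(m+1)(n+1) + (m+1) - 1. *)
rewrite -(mulrA (x ^+ (2 * m + 1))) (mulrC _^-1) mulrA -exprD -mulrA -invfM.
rewrite (mulrC (1 + _)); congr (x ^+ _ / _); lia.
Qed.

Theorem theorem5p7 (R : realType) (q : R[i]) (hq : `|q| < 1) :
  let C : numFieldType := R[i] in
  let lhs (m n : nat) : C :=
    (- q) ^+ (2 * m * n + m - 1)
      / ((1 + q ^+ (2 * n - 1)) * (1 - q ^+ (2 * m - 1))) in
  let rhs (n : nat) : C :=
    q ^+ (4 * n - 2) / (1 - q ^+ (4 * n - 2)) ^+ 2 in
  [/\ cvg (summability.partial_sum (fun k : nat * nat => lhs k.1.+1 k.2.+1)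
             @ summability.totally),
      cvg ((fun N => \sum_(1 <= n < N) rhs n) @ \oo)
    & summability.sum (fun k : nat * nat => lhs k.1.+1 k.2.+1)
      = \big[+%R/0]_(1 <= n <oo) rhs n].
Proof.
move=> C lhs rhs.
have := has_sum_double_series (- q : C) (complex_abs_complete R).
rewrite normrN => /(_ hq) [s [hr hl]].
(* At odd exponents the sign comes out, which turns the denominators in -q into those in q. *)
have odd_opp (n : nat) : (- q) ^+ (2 * n + 1) = - (q ^+ (2 * n + 1)).
  by rewrite exprNn -signr_odd oddD oddM /= expr1 mulN1r.
have {}hl : has_sum (fun k : nat * nat => lhs k.1.+1 k.2.+1) s.
  move: hl; congr (has_sum _ _); apply/funext => -[m n]; rewrite /lhs /= !odd_opp opprK.
  by congr (_ / ((1 + _ ^+ _) * (1 - _ ^+ _))); lia.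
have {}hr : (\sum_(1 <= n < N) rhs n) @[N --> \oo] --> s.
  (* The series starts at 1, so its partial sum up to N + 1 is matched with the zero-based one up to
     N. *)
  rewrite -(cvg_shiftn 1) /=; move: (has_sum_cvg_series hr).
  rewrite (_ : (fun N => _) = (fun N => \sum_(1 <= n < N + 1) rhs n)) //; apply/funext => N.
  rewrite big_add1 addn1 /=; apply: eq_bigr => n _.
  (* Here 2(2n+1) = 4(n+1) - 2 is even, so the sign of -q disappears. *)
  rewrite /rhs /csch expr_div_n -exprM (_ : (2 * (2 * n + 1)) = 4 * n.+1 - 2)%N; last by lia.
  rewrite (_ : ((2 * n + 1) * 2) = 4 * n.+1 - 2)%N; last by lia.
  by rewrite (_ : (4 * n.+1 - 2) = 2 * (2 * n + 1))%N ?(exprM (- q)) ?sqrrN -?exprM//; lia.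
split.
- by apply/cvg_ex; exists s.
- by apply/cvg_ex; exists s.
- by rewrite /summability.sum (cvg_lim _ hl)// (cvg_lim _ hr)//.
Qed.
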